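(* Let $r\ge1$, let $a_0,\dots,a_r\in\mathbb R[x]$ with $a_r\not\equiv0$, write $a_j(x)=\sum_{s=0}^{d_j}a_{j,s}x^s$ with $d_j=\deg a_j$, and let $K$ be a real function on an interval, $r$ times differentiable, satisfying $$a_r(x)K^{(r)}(x)+\cdots+a_1(x)K'(x)+a_0(x)K(x)=0 .$$ Then for integers $n\ge0$ the moments $I_n(x)=\int x^nK(x)\,dx$ satisfy a finite recurrence $$\sum_kC_k(n)I_{n+k}(x)=E_n(x),$$ where $C_k(n)\in\mathbb R[n]$ and $E_n(x)$ is an explicit linear combination of functions of the form $x^mK(x),x^mK'(x),\ldots,x^mK^{(r-1)}(x)$. More precisely, $$C_k(n)=\sum_{0\le j\le r,\; 0\le s\le d_j,\; s-j=k}(-1)^ja_{j,s}\,(n+s)_{\underline j}.$$ Only finitely many coefficients $C_k$ are nonzero, and their possible shifts satisfy $$-r\le k\le\max_{0\le j\le r}(d_j-j).$$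
   Context: $(t)_{\underline j}=t(t-1)\cdots(t-j+1)$, $(t)_{\underline 0}=1$ is the falling factorial. Indices $j$ with $a_j\equiv0$ contribute nothing and are omitted from sums and maxima. $\int f\,dx$ denotes an antiderivative on the interval; identities between antiderivatives hold up to an additive constant. Terms $C_k(n)I_{n+k}$ with $n+k<0$ have coefficient $C_k(n)=0$ and are read as zero. *)

(* Defs.v *)
From HB Require Import structures.
From mathcomp Require Import all_boot all_order all_algebra.
From mathcomp Require Import all_classical all_reals all_analysis.

Set Implicit Arguments.
Unset Strict Implicit.
Unset Printing Implicit Defensive.

Import Order.TTheory GRing.Theory Num.Theory.
Import numFieldNormedType.Exports.

Local Open Scope classical_set_scope.
Local Open Scope ring_scope.

(* Derivatives are taken relative to the interval J (y --> x with y in J and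
   y != x), so an endpoint belonging to J gets its one-sided derivative, and
   only the values of the function on J matter. *)
Section relative_derivative.
Context {R : realType}.
Implicit Types (J : set R) (f F : R -> R) (x : R).

Definition diff_quot f x (y : R) : R := (f y - f x) / (y - x).

Definition derivable_in J f x : Prop :=
  cvg (diff_quot f x @ within J x^').

Definition derive_in J f x : R := lim (diff_quot f x @ within J x^').

Definition derive_inn (i : nat) J f : R -> R := iter i (derive_in J) f.

Definition derivable_inn (r : nat) J f : Prop :=
  forall i : nat, (i < r)%N ->
    forall x, J x -> derivable_in J (derive_inn i J f) x.

Definition antiderivative J f F : Prop :=
  forall x, J x -> diff_quot F x @ within J x^' --> f x.

End relative_derivative.

Definition falling (A : nzRingType) (t : A) (j : nat) : A :=
  \prod_(i < j) (t - i%:R).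

(* [size p = deg p + 1], and [size 0 = 0], so that indices j with a_j = 0
   contribute nothing to sums over [s < size (a j)]. *)
Section recurrence.
Context {R : realType} {r : nat}.
Implicit Types (a : 'I_r.+1 -> {poly R}) (J : set R) (K : R -> R).

Definition solves_ode a J K : Prop :=
  forall x, J x -> \sum_(j < r.+1) (a j).[x] * derive_inn j J K x = 0.

(* C_k as a polynomial; its variable 'X stands for n. *)
Definition rec_coef a (k : int) : {poly R} :=
  \sum_(j < r.+1) \sum_(s < size (a j) | s%:Z - j%:Z == k)
    ((-1) ^+ j * (a j)`_s) *: falling ('X + s%:R) j.

(* The maximum of deg a_j - j over the j with a_j != 0; the default value is
   the term j = r, which is in the range whenever a_r != 0. *)
Definition max_shift a : int :=
  \big[Num.max/ (size (a ord_max)).-1%:Z - r%:Z]_(j < r.+1 | a j != 0)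
    ((size (a j)).-1%:Z - j%:Z).

(* The boundary terms of the repeated integration by parts of x^n a_j K^(j),
   moved to the right-hand side; here (x^(n+s))^(i) is written
   (n+s)(n+s-1)...(n+s-i+1) x^(n+s-i), whose coefficient vanishes when the
   truncated exponent n + s - i is not the true one. *)
Definition boundary a J K (n : nat) (x : R) : R :=
  \sum_(j < r.+1) \sum_(s < size (a j)) \sum_(i < j)
    ((-1) ^+ i.+1 * (a j)`_s * falling (n + s)%:R i) *
      (x ^+ (n + s - i) * derive_inn (j - i.+1) J K x).

End recurrence.

(* A family indexed by nat, read as zero at negative indices. *)
Definition at_int (R : realType) (F : nat -> R -> R) (m : int) : R -> R :=
  if m is Posz m' then F m' else fun=> 0.

(* Main.v *)
Require Import Defs.
From HB Require Import structures.
From mathcomp Require Import all_boot all_order all_algebra.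
From mathcomp Require Import all_classical all_reals all_analysis.
From mathcomp Require Import ring zify.
Import Order.TTheory GRing.Theory Num.Theory.
Import numFieldNormedType.Exports.
Local Open Scope classical_set_scope.
Local Open Scope ring_scope.

(* Multiply the equation by x^n, expand each a_j into monomials and integrate
   x^(n+s) K^(j) by parts j times: what is left under the integral is
   (-1)^j (n+s)(n+s-1)...(n+s-j+1) x^(n+s-j) K, and collecting s - j = k gives
   C_k(n).  Rather than manipulating antiderivatives, one checks that the two
   sides of the recurrence have the same derivative along J, so that their
   difference is constant on the interval by the mean value theorem. *)

(** * Calculus of derivatives along a set *)

Section relative_derivative.
Context {R : realType}.
Implicit Types (J : set R) (f g F : R -> R) (x l m : R).

(** Relational form: [antiderivative] unfolds to it directly, and the rules below carry the value of
    the derivative along without ever computing a [lim]. *)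
Definition has_derive_in J f x l : Prop := diff_quot f x @ within J x^' --> l.

Lemma has_derive_in_cst J (c x : R) : has_derive_in J (fun=> c) x 0.
Proof.
rewrite /has_derive_in.
have -> : diff_quot (fun=> c) x = fun=> 0.
  by apply/funext => y; rewrite /diff_quot subrr mul0r.
exact: cvg_cst.
Qed.

Lemma has_derive_in_id J x : has_derive_in J id x 1.
Proof.
apply: cvg_near_cst; apply: filterS (nbhs_dnbhs_neq x) => y yx _.
by rewrite /diff_quot divff// subr_eq0.
Qed.

Lemma has_derive_inD J f g x l m : has_derive_in J f x l ->
  has_derive_in J g x m -> has_derive_in J (fun y => f y + g y) x (l + m).
Proof.
move=> fl gm; rewrite /has_derive_in.
have -> : diff_quot (fun y => f y + g y) x = diff_quot f x + diff_quot g x.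
  by apply/funext => y; rewrite /diff_quot fctE/= -mulrDl addrACA opprD.
exact: cvgD fl gm.
Qed.

(** For [y != x], [f y] equals [f x + diff_quot f x y * (y - x)], whose last term tends to
    [l * 0]. *)
Lemma has_derive_in_continuous J f x l : has_derive_in J f x l ->
  f @ within J x^' --> f x.
Proof.
move=> fl.
have idx : (fun y : R => y) @ within J x^' --> x.
  by apply: cvg_within_filter; apply: cvg_within_filter; exact: cvg_id.
have : (fun y => f x + diff_quot f x y * (y - x)) @ within J x^'
    --> f x + l * (x - x).
  by apply: cvgD; [exact: cvg_cst|apply: cvgM => //;
    apply: cvgB => //; exact: cvg_cst].
rewrite subrr mulr0 addr0; apply: cvg_trans; apply: near_eq_cvg.
apply: filterS (nbhs_dnbhs_neq x) => y yx _.
by rewrite /diff_quot divfK ?subr_eq0// addrC subrK.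
Qed.

Lemma has_derive_inM J f g x l m : has_derive_in J f x l ->
  has_derive_in J g x m ->
  has_derive_in J (fun y => f y * g y) x (l * g x + f x * m).
Proof.
move=> fl gm; rewrite /has_derive_in.
have -> : diff_quot (fun y => f y * g y) x =
    (fun y => diff_quot f x y * g x + f y * diff_quot g x y).
  by apply/funext => y; rewrite /diff_quot; ring.
apply: cvgD; first by apply: cvgM => //; exact: cvg_cst.
by apply: cvgM => //; exact: has_derive_in_continuous fl.
Qed.

Lemma has_derive_inZ J f x (c l : R) : has_derive_in J f x l ->
  has_derive_in J (fun y => c * f y) x (c * l).
Proof.
move=> fl; have := has_derive_inM _ _ _ _ _ _ (has_derive_in_cst J c x) fl.
by rewrite mul0r add0r.
Qed.

Lemma has_derive_in_sum J (I : Type) (s : seq I) (f : I -> R -> R)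
    (l : I -> R) x : (forall i, has_derive_in J (f i) x (l i)) ->
  has_derive_in J (fun y => \sum_(i <- s) f i y) x (\sum_(i <- s) l i).
Proof.
move=> fl; elim: s => [|i s IH].
  rewrite big_nil; under eq_fun do rewrite big_nil; exact: has_derive_in_cst.
rewrite big_cons; under eq_fun do rewrite big_cons; exact: has_derive_inD.
Qed.

Lemma has_derive_inX J (k : nat) x :
  has_derive_in J (fun y => y ^+ k) x (k%:R * x ^+ k.-1).
Proof.
elim: k => [|k IH].
  by under eq_fun do rewrite expr0; rewrite mul0r; exact: has_derive_in_cst.
under eq_fun do rewrite exprS.
have -> : k.+1%:R * x ^+ k.+1.-1 = 1 * x ^+ k + x * (k%:R * x ^+ k.-1).
  (* At [k = 0] the predecessor [k.-1] is truncated, but its coefficient [0%:R] removes the term. *)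
  case: k {IH} => [|k] /=; first by rewrite mul0r mulr0 addr0.
  by rewrite exprS -[k.+2]addn1 natrD; ring.
exact: has_derive_inM (has_derive_in_id J x) IH.
Qed.

(* [G --> x^'] is filter inclusion, so this turns the derivative along [J]
   into a one-sided or a two-sided one. *)
Lemma cvg_within_dnbhs J x (G : set_system R) : Filter G ->
  G --> x^' -> G J -> G --> within J x^'.
Proof.
move=> FG Gx GJ B /Gx GB; apply: filterS2 GB GJ => y; exact.
Qed.

(** The usual derivative is a limit in the increment [h], while [diff_quot] is a quotient in the
    moving point [y]; the substitution [y = h + x] passes between them. *)
Lemma cvg_shift_dnbhs x : h + x @[h --> (0 : R)^'] --> x^'.
Proof.
move=> B; rewrite /dnbhs /within/= => xB.
have idx : h + x @[h --> (0 : R)] --> x.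
  have : h + x @[h --> (0 : R)] --> 0 + x.
    by apply: cvgD; [exact: cvg_id|exact: cvg_cst].
  by rewrite add0r.
have xB' := idx _ xB; rewrite !nbhs_simpl/= in xB' *.
apply: (filterS _ xB') => h /= hB h0; apply: hB.
by rewrite -subr_eq0 addrK.
Qed.

(** Two points of [J] span a segment inside [J], to which the mean value theorem applies: the
    derivative along [J] is two-sided at interior points of the segment and still yields one-sided
    continuity at its ends. *)
Lemma zero_derive_in_cst J F : is_interval J ->
  (forall x, J x -> has_derive_in J F x 0) ->
  forall u v, J u -> J v -> F u = F v.
Proof.
move=> Jitv F0.
suff lt_eq u v : J u -> J v -> u < v -> F u = F v.
  move=> u v Ju Jv; have [uv|vu|->//] := ltgtP u v; first exact: lt_eq.
  by apply/esym; exact: lt_eq.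
move=> Ju Jv uv.
have Juv x : u <= x <= v -> J x by exact: (Jitv u v).
(* Strictly between [u] and [v], [J] is a neighbourhood of [x], so restricting to [J] loses
   nothing. *)
have nearJ x : x \in `]u, v[ -> x^' --> within J x^'.
  move=> xuv; apply: cvg_within_dnbhs => //; apply: nbhs_dnbhs.
  apply: filterS (near_in_itvoo xuv) => y; rewrite in_itv/= => /andP[uy yv].
  by apply: Juv; rewrite !ltW.
have inJ x : x \in `]u, v[ -> J x.
  by rewrite in_itv/= => /andP[ux xv]; apply: Juv; rewrite !ltW.
have dF x : x \in `]u, v[ -> is_derive x 1 F 0.
  move=> xuv.
  have FD : h^-1 *: ((F \o shift x) (h *: 1) - F x) @[h --> 0^'] --> (0 : R).
    have Fx : diff_quot F x @ x^' --> 0.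
      have := F0 x (inJ _ xuv); rewrite /has_derive_in; apply: cvg_trans.
      by apply: cvg_app; exact: nearJ.
    have := cvg_comp _ _ (cvg_shift_dnbhs x) Fx.
    apply: cvg_trans; apply: near_eq_cvg; near=> h.
    by rewrite /diff_quot/= addrK scaler1 mulrC.
  apply: DeriveDef; last exact/cvg_lim.
  by apply/cvg_ex; exists 0.
have cF : {within `[u, v], continuous F}.
  apply/continuous_within_itvP => //; split.
  - move=> x xuv; apply: differentiable_continuous; apply/derivable1_diffP.
    by have [] := dF x xuv.
  (* Only the right-hand limit is needed at [u], and points slightly to the right of [u] lie in [J];
     symmetrically at [v]. *)
  - apply: cvg_trans (has_derive_in_continuous _ _ _ _ (F0 u Ju)).
    apply: cvg_app; apply: cvg_within_dnbhs.
      move=> A; rewrite /dnbhs /at_right /within !nbhs_simpl/= => A'.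
      apply: (filterS _ A') => y /= + uy; apply.
      by rewrite gt_eqF.
    near=> y; apply: Juv; apply/andP; split; first exact: ltW.
    by near: y; exact: nbhs_right_ltW.
  - apply: cvg_trans (has_derive_in_continuous _ _ _ _ (F0 v Jv)).
    apply: cvg_app; apply: cvg_within_dnbhs.
      move=> A; rewrite /dnbhs /at_left /within !nbhs_simpl/= => A'.
      apply: (filterS _ A') => y /= + yv; apply.
      by rewrite lt_eqF.
    near=> y; apply: Juv; apply/andP; split; last exact: ltW.
    by near: y; exact: nbhs_left_ge.
have [c _] := MVT_segment (ltW uv) dF cF.
by rewrite mul0r => /eqP; rewrite subr_eq0 => /eqP.
Unshelve. all: by end_near. Qed.

End relative_derivative.

(** Truncated subtraction does no harm: for [j > m] the product on the left contains the factor
    [m - m], and both sides vanish. *)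
Lemma falling_nat (A : nzRingType) (m j : nat) :
  falling (m%:R : A) j = (m ^_ j)%:R.
Proof.
elim: j => [|j IH]; first by rewrite /falling big_ord0 ffactn0.
rewrite /falling big_ord_recr/= -/(falling _ _) IH ffactnSr natrM.
have [jm|mj] := leqP j m; first by rewrite natrB.
by rewrite ffact_small// !mul0r.
Qed.

(** * Recurrence coefficients, and derivatives of moments and boundary terms *)

Section recurrence.
Context {R : realType} {r : nat}.
Implicit Types (a : 'I_r.+1 -> {poly R}) (J : set R) (K : R -> R).

Lemma horner_rec_coef a (k : int) (n : nat) :
  (rec_coef a k).[n%:R] =
  \sum_(j < r.+1) \sum_(s < size (a j) | s%:Z - j%:Z == k)
    (-1) ^+ j * (a j)`_s * ((n + s) ^_ j)%:R.
Proof.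
rewrite /rec_coef horner_sum; apply: eq_bigr => j _.
rewrite horner_sum; apply: eq_bigr => s _.
rewrite hornerZ -falling_nat /falling horner_prod; congr (_ * _).
by apply: eq_bigr => i _; rewrite -!polyC_natr !hornerE natrD.
Qed.

Lemma rec_coef_neq0 a (k : int) : rec_coef a k != 0 ->
  exists (j : 'I_r.+1) (s : 'I_(size (a j))), k = s%:Z - j%:Z.
Proof.
move=> ak; apply: contrapT => nex; move/eqP: ak; apply.
rewrite /rec_coef big1// => j _; rewrite big1// => s /eqP sk.
by exfalso; apply: nex; exists j, s.
Qed.

(** A finite support for [rec_coef a], free of duplicates so that a sum over all integers can be
    turned into a sum along this list. *)
Definition shifts a : seq int :=
  undup [seq s%:Z - (nat_of_ord j)%:Z |
           j <- enum 'I_r.+1, s <- iota 0 (size (a j))].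

Lemma mem_shifts a (j : 'I_r.+1) (s : 'I_(size (a j))) :
  s%:Z - j%:Z \in shifts a.
Proof.
rewrite mem_undup; apply/allpairsPdep; exists j, (s : nat).
by split; rewrite ?mem_enum ?mem_iota ?add0n ?ltn_ord.
Qed.

Lemma sum_rec_coef a (n : nat) (g : int -> R) :
  \sum_(k \in [set: int]) (rec_coef a k).[n%:R] * g k =
  \sum_(j < r.+1) \sum_(s < size (a j))
    (-1) ^+ j * (a j)`_s * ((n + s) ^_ j)%:R * g (s%:Z - j%:Z).
Proof.
rewrite -(fsbig_widen [set` shifts a])//=; last first.
  move=> k [_ /=] kS; apply: contrapT => /eqP.
  rewrite mulf_eq0 negb_or => /andP[ak _]; apply: kS.
  have /rec_coef_neq0[j [s ->]] : rec_coef a k != 0.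
    by apply: contra ak => /eqP ->; rewrite horner0.
  exact: mem_shifts.
rewrite -fsbig_seq ?undup_uniq//.
under eq_bigr do rewrite horner_rec_coef big_distrl/=.
rewrite exchange_big/=; apply: eq_bigr => j _.
under eq_bigr do rewrite big_distrl/= big_mkcond/=.
rewrite exchange_big/=; apply: eq_bigr => s _.
(* Each pair [(j, s)] feeds exactly one coefficient, that of the shift [s - j]. *)
rewrite (bigD1_seq (s%:Z - j%:Z)) ?undup_uniq ?mem_shifts//= eqxx.
by rewrite big1 ?addr0// => k /negbTE; rewrite eq_sym => ->.
Qed.

(** With [k = s - j], the hypothesis says [n + s < j], so every falling factorial in the coefficient
    vanishes. *)
Lemma rec_coef_eq0 a (n : nat) (k : int) : n%:Z + k < 0 ->
  (rec_coef a k).[n%:R] = 0.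
Proof.
move=> nk; rewrite horner_rec_coef big1// => j _; rewrite big1// => s /eqP sk.
by rewrite ffact_small ?mulr0//; lia.
Qed.

Lemma finite_rec_coef a : finite_set [set k : int | rec_coef a k != 0].
Proof.
apply: (@sub_finite_set _ _ [set` shifts a]) => //.
by move=> k /= /rec_coef_neq0[j [s ->]]; exact: mem_shifts.
Qed.

Lemma rec_coef_range a (k : int) : rec_coef a k != 0 ->
  - r%:Z <= k /\ k <= max_shift a.
Proof.
move=> /rec_coef_neq0[j [s ->]]; have jr := ltn_ord j.
split; first by lia.
have ltsz := ltn_ord s.
apply: (@bigmax_sup _ _ _ _ j); last by lia.
(* The existence of an index [s < size (a j)] shows that [a j] is nonzero, so [j] takes part in the
   maximum. *)
by rewrite -size_poly_gt0; exact: leq_ltn_trans ltsz.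
Qed.

(* [T k] is [(-1)^k (y^m)^(k) K^(j-k)] at [x]. *)
Lemma has_derive_in_boundary_term J K (m j i : nat) (c x : R) :
  derivable_inn r J K -> J x -> (i < j)%N -> (j <= r)%N ->
  let T k := (-1) ^+ k * (m ^_ k)%:R *
             (x ^+ (m - k) * derive_inn (j - k) J K x) in
  has_derive_in J
    (fun y => (-1) ^+ i.+1 * c * falling m%:R i *
      (y ^+ (m - i) * derive_inn (j - i.+1) J K y))
    x (c * (T i.+1 - T i)).
Proof.
move=> Kr Jx ij jr T.
have dK : has_derive_in J (derive_inn (j - i.+1) J K) x
    (derive_inn (j - i) J K x).
  by rewrite -[in X in derive_inn X _ _ x](subnSK ij); apply: Kr => //; lia.
have := has_derive_inZ _ _ _ ((-1) ^+ i.+1 * c * falling m%:R i) _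
  (has_derive_inM _ _ _ _ _ _ (has_derive_inX J (m - i) x) dK).
congr has_derive_in.
(* The factor [m - i] from differentiating the power turns [m ^_ i] into [m ^_ i.+1], giving
   [T i.+1]; differentiating K gives [- T i]. *)
by rewrite /T falling_nat ffactnSr natrM -subnS exprS; ring.
Qed.

(** For [j > m] the coefficient [m ^_ j] is zero, so neither the default value of [at_int] nor the
    truncated exponent matters. *)
Lemma has_derive_in_moment J K (mom : nat -> R -> R) (m j : nat) (x : R) :
  (forall n, antiderivative J (fun y => y ^+ n * K y) (mom n)) -> J x ->
  has_derive_in J (fun y => (m ^_ j)%:R * at_int mom (m%:Z - j%:Z) y) x
    ((m ^_ j)%:R * (x ^+ (m - j) * K x)).
Proof.
move=> momK Jx; have [jm|mj] := leqP j m.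
  by rewrite subzn//=; apply: has_derive_inZ; exact: momK.
rewrite ffact_small// mul0r; under eq_fun do rewrite mul0r.
exact: has_derive_in_cst.
Qed.

(** The sum over [i] telescopes to the term with all [j] derivatives on the power minus the term
    with all of them on K. The latter terms add up to [x ^+ n] times the differential equation,
    hence to zero. *)
Lemma has_derive_in_boundary a J K (n : nat) (x : R) :
  derivable_inn r J K -> solves_ode a J K -> J x ->
  has_derive_in J (boundary a J K n) x
    (\sum_(j < r.+1) \sum_(s < size (a j))
      (-1) ^+ j * (a j)`_s * ((n + s) ^_ j)%:R * (x ^+ (n + s - j) * K x)).
Proof.
move=> Kr Kode Jx.
set T := fun (j : 'I_r.+1) s k => (-1) ^+ k * ((n + s) ^_ k)%:R *
  (x ^+ (n + s - k) * derive_inn (j - k) J K x).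
have bT : has_derive_in J (boundary a J K n) x
    (\sum_(j < r.+1) \sum_(s < size (a j)) \sum_(i < j)
      (a j)`_s * (T j s i.+1 - T j s i)).
  apply: has_derive_in_sum => j; apply: has_derive_in_sum => s.
  apply: has_derive_in_sum => i.
  by apply: has_derive_in_boundary_term => //; rewrite -ltnS.
have ode_n : \sum_(j < r.+1) \sum_(s < size (a j)) (a j)`_s * T j s 0%N = 0.
  rewrite -[RHS](mulr0 (x ^+ n)) -[in RHS](Kode x Jx) mulr_sumr.
  apply: eq_bigr => j _.
  rewrite horner_coef mulr_suml mulr_sumr; apply: eq_bigr => s _.
  by rewrite /T ffactn0 !subn0 exprD; ring.
move: bT; congr has_derive_in.
rewrite -[RHS]subr0 -[X in _ = _ - X]ode_n -sumrB.
apply: eq_bigr => j _; rewrite -sumrB; apply: eq_bigr => s _.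
rewrite -mulr_sumr -(big_mkord xpredT (fun i => T j s i.+1 - T j s i)).
rewrite telescope_sumr// mulrBr; congr (_ - _).
by rewrite /T subnn /=; ring.
Qed.

End recurrence.

(** * Assembling the recurrence *)

Theorem theorem5p1 (R : realType) (r : nat) (a : 'I_r.+1 -> {poly R})
    (J : set R) (K : R -> R) (mom : nat -> R -> R)
    (r_ge1 : (1 <= r)%N)
    (ar_neq0 : a ord_max != 0)
    (J_interval : is_interval J)
    (K_derivable : derivable_inn r J K)
    (K_ode : solves_ode a J K)
    (mom_antiderivative :
       forall n : nat, antiderivative J (fun x => x ^+ n * K x) (mom n)) :
  [/\ forall n : nat, exists c : R, forall x : R, J x ->
        \sum_(k \in [set: int])
           (rec_coef a k).[n%:R] * at_int mom (n%:Z + k) x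
        = boundary a J K n x + c,
      forall (n : nat) (k : int), n%:Z + k < 0 -> (rec_coef a k).[n%:R] = 0,
      finite_set [set k : int | rec_coef a k != 0] &
      forall k : int, rec_coef a k != 0 ->
        - r%:Z <= k /\ k <= max_shift a].
Proof.
split; [|exact: rec_coef_eq0|exact: finite_rec_coef|exact: rec_coef_range].
move=> n.
(* The falling factorial is kept next to its moment, so that [has_derive_in_moment] applies even
   when the index of the moment is negative. *)
pose lhs x := \sum_(j < r.+1) \sum_(s < size (a j))
  (-1) ^+ j * (a j)`_s *
    (((n + s) ^_ j)%:R * at_int mom ((n + s)%:Z - j%:Z) x).
have lhsE x : \sum_(k \in [set: int])
    (rec_coef a k).[n%:R] * at_int mom (n%:Z + k) x = lhs x.
  rewrite (sum_rec_coef a n (fun k => at_int mom (n%:Z + k) x)).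
  apply: eq_bigr => j _; apply: eq_bigr => s _.
  by rewrite PoszD addrA mulrA.
have dG x : J x -> has_derive_in J (fun y => lhs y - boundary a J K n y) x 0.
  move=> Jx.
  have dl : has_derive_in J lhs x (\sum_(j < r.+1) \sum_(s < size (a j))
      (-1) ^+ j * (a j)`_s * (((n + s) ^_ j)%:R * (x ^+ (n + s - j) * K x))).
    apply: has_derive_in_sum => j; apply: has_derive_in_sum => s.
    by apply: has_derive_inZ; exact: has_derive_in_moment.
  have db := has_derive_inZ _ _ _ (-1) _
    (has_derive_in_boundary a J K n x K_derivable K_ode Jx).
  have := has_derive_inD _ _ _ _ _ _ dl db.
  under eq_fun do rewrite mulN1r.
  rewrite mulN1r; congr has_derive_in; rewrite -sumrB big1// => j _.
  by rewrite -sumrB big1// => s _; rewrite !mulrA subrr.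
(* Any point of [J] determines the constant; if [J] is empty the identity is vacuous and 0
   serves. *)
have [[x0 Jx0]|J0] := pselect (exists x, J x).
  exists (lhs x0 - boundary a J K n x0) => x Jx; rewrite lhsE.
  by rewrite -(zero_derive_in_cst _ _ J_interval dG _ _ Jx Jx0) addrC subrK.
by exists 0 => x Jx; exfalso; apply: J0; exists x.
Qed.
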